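(* Let $\mathbb{X}_V$ be the shift induced by the visible lattice points of $\mathbb{Z}^2$ and let $\mathbb{X}_{\mathrm{G}}$ be the shift induced by the square-free Gaussian integers. Then neither of the two shifts $(\mathbb{X}_V,\mathbb{Z}^2)$ and $(\mathbb{X}_{\mathrm{G}},\mathbb{Z}^2)$ is a topological factor of the other.
   Context: Subsets of $\mathbb{Z}^2$ are identified with their characteristic functions in $\{0,1\}^{\mathbb{Z}^2}$ (product topology), with $\mathbb{Z}^2$ acting by translation. The visible lattice points are $V=\{(m,n)\in\mathbb{Z}^2 : \gcd(m,n)=1\}=\mathbb{Z}^2\setminus\bigcup_p p\,\mathbb{Z}^2$, where $p$ runs through the rational primes. The square-free Gaussian integers give the set $V_{\mathrm{G}}=\{(m,n)\in\mathbb{Z}^2 : m+n\mathrm{i}\neq 0\text{ is not divisible by the square of any Gaussian prime}\}$. Set $\mathbb{X}_V=\overline{\{t+V : t\in\mathbb{Z}^2\}}$ and $\mathbb{X}_{\mathrm{G}}=\overline{\{t+V_{\mathrm{G}} : t\in\mathbb{Z}^2\}}$. A shift $(\mathbb{Y},\mathbb{Z}^2)$ is a topological factor of $(\mathbb{X},\mathbb{Z}^2)$ if there is a continuous surjection $\phi:\mathbb{X}\to\mathbb{Y}$ that commutes with the $\mathbb{Z}^2$-translation actions (same translation group acting on both). *)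

(* Defs.v *)
From HB Require Import structures.
From mathcomp Require Import all_boot all_order all_algebra ring.
From mathcomp Require Import boolp classical_sets topology.

Set Implicit Arguments.
Unset Strict Implicit.
Unset Printing Implicit Defensive.

Import Order.TTheory GRing.Theory Num.Theory.

Local Open Scope classical_set_scope.
Local Open Scope ring_scope.

(* [Gauss m n] is m + n i; see [GaussE]. *)
Record gaussint := Gauss { gre : int; gim : int }.

Definition gauss_pair (z : gaussint) : int * int := (gre z, gim z).
Definition pair_gauss (u : int * int) : gaussint := Gauss u.1 u.2.

Lemma gauss_pairK : cancel gauss_pair pair_gauss.
Proof. by case. Qed.

HB.instance Definition _ := Choice.copy gaussint (can_type gauss_pairK).

Definition gauss_opp (x : gaussint) := Gauss (- gre x) (- gim x).
Definition gauss_add (x y : gaussint) := Gauss (gre x + gre y) (gim x + gim y).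
Definition gauss_mul (x y : gaussint) :=
  Gauss (gre x * gre y - gim x * gim y) (gre x * gim y + gim x * gre y).

Lemma gauss_addA : associative gauss_add.
Proof. by move=> x y z; rewrite /gauss_add /= !addrA. Qed.

Lemma gauss_addC : commutative gauss_add.
Proof. by move=> x y; rewrite /gauss_add addrC [gim x + _]addrC. Qed.

Lemma gauss_add0 : left_id (Gauss 0 0) gauss_add.
Proof. by case=> a b; rewrite /gauss_add /= !add0r. Qed.

Lemma gauss_addN : left_inverse (Gauss 0 0) gauss_opp gauss_add.
Proof. by move=> x; rewrite /gauss_add /= !addNr. Qed.

HB.instance Definition _ := GRing.isZmodule.Build gaussint
  gauss_addA gauss_addC gauss_add0 gauss_addN.

Lemma gauss_mulA : associative gauss_mul.
Proof. by move=> x y z; congr Gauss => /=; ring. Qed.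

Lemma gauss_mulC : commutative gauss_mul.
Proof. by move=> x y; congr Gauss => /=; ring. Qed.

Lemma gauss_mul1 : left_id (Gauss 1 0) gauss_mul.
Proof. by case=> a b; congr Gauss => /=; ring. Qed.

Lemma gauss_mulD : left_distributive gauss_mul +%R.
Proof. by move=> x y z; congr Gauss => /=; ring. Qed.

Lemma gauss_1neq0 : Gauss 1 0 != 0.
Proof. by []. Qed.

HB.instance Definition _ := GRing.Zmodule_isComNzRing.Build gaussint
  gauss_mulA gauss_mulC gauss_mul1 gauss_mulD gauss_1neq0.

Definition gauss_i : gaussint := Gauss 0 1.

Lemma gauss_i_sqr : gauss_i ^+ 2 = -1.
Proof. by []. Qed.

Lemma gauss_intr (m : int) : m%:~R = Gauss m 0.
Proof.
have natE (n : nat) : n%:R = Gauss n 0.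
  by elim: n => // n IHn; rewrite -natr1 IHn; congr Gauss; rewrite intS addrC.
by case: m => n; [exact: natE | rewrite NegzE mulrNz -pmulrn natE].
Qed.

Lemma GaussE (m n : int) : Gauss m n = m%:~R + n%:~R * gauss_i.
Proof. by rewrite !gauss_intr; congr Gauss => /=; ring. Qed.

Definition divides (R : comNzRingType) (d x : R) : Prop := exists c, x = c * d.

Definition prime_element (R : comNzRingType) (p : R) : Prop :=
  [/\ p != 0, ~ divides p 1
    & forall a b, divides p (a * b) -> divides p a \/ divides p b].

Definition visible_points : set (int * int) := [set u | gcdz u.1 u.2 = 1].

Definition squarefree_gauss : set (int * int) :=
  [set u | Gauss u.1 u.2 != 0 /\
           forall p : gaussint, prime_element p ->
             ~ divides (p ^+ 2) (Gauss u.1 u.2)].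

Definition config := prod_topology (fun _ : int * int => bool).

Definition charfun (A : set (int * int)) : config := fun x => x \in A.

(* The sign is such that [translate t (charfun A)] is the characteristic
   function of t + A. *)
Definition translate (t : int * int) (w : config) : config := fun x => w (x - t).

Definition orbit_closure (A : set (int * int)) : set config :=
  closure [set translate t (charfun A) | t in [set: int * int]].

Definition X_V : set config := orbit_closure visible_points.
Definition X_G : set config := orbit_closure squarefree_gauss.

(* A map X -> Y is given by a total map on configurations, of which only the
   restriction to X matters; {within X, continuous phi} is continuity for the
   subspace topology of X. *)
Definition topological_factor (Y X : set config) : Prop :=
  exists phi : config -> config,
    [/\ {within X, continuous phi}, phi @` X = Y
      & forall t w, X w -> phi (translate t w) = translate t (phi w)].

(* Main.v *)
Require Import Defs.
From mathcomp Require Import all_boot all_order all_algebra ring lra zify.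
From mathcomp Require Import boolp classical_sets topology.

Set Implicit Arguments.
Unset Strict Implicit.
Unset Printing Implicit Defensive.

Import Order.TTheory GRing.Theory Num.Theory.

Local Open Scope classical_set_scope.
Local Open Scope ring_scope.

(* Suppose a factor map sends the orbit closure of A onto that of B. By
   continuity, the image of A contains a translate of all return times of some
   finite pattern of A, that is, of all x such that A - x and A agree on a finite
   set F. So if these return times meet every class modulo some ideal (or every
   class modulo p), then an element of the orbit closure of B meets every such
   class, which is impossible as soon as B avoids the zero class.

   For A = V, B = V_G the ideal is generated by the square of a Gaussian prime g
   over a large split prime q: the integers surject onto Z[i]/(g^2), so x can run
   through all classes modulo g^2 while x + u stays nonzero modulo q for u in F.
   For A = V_G, B = V the modulus is a large prime p = 3 mod 4: x can run through
   all classes modulo p while x + u stays nonzero modulo p^2, and p is a Gaussian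
   prime. The remaining primes are handled by the Chinese remainder theorem for V
   and by a square-free sieve over a box for V_G. *)

(** * Factor maps and return times *)

Definition cylinder (w : config) (F : seq (int * int)) : set config :=
  [set w' | {in F, forall u, w' u = w u}].

Lemma nbhs_cylinder (w : config) F : nbhs w (cylinder w F).
Proof.
elim: F => [|u F IH].
  by apply: filterS (filterT : nbhs w setT) => w' _ v; rewrite in_nil.
have Hu : nbhs w [set w' : config | w' u = w u].
  have := @proj_continuous (int * int)%type (fun _ => bool) u w [set w u].
  by apply; rewrite nbhs_principalE.
apply: filterS (filterI Hu IH) => w' [/= E1 E2] v.
by rewrite inE => /orP[/eqP->|/E2].
Qed.

(** The product topology is initial for the coordinates, so the filter generated by the cylinders at
    [w] converges to [w] as soon as every coordinate does, and one coordinate is fixed by a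
    one-point cylinder. *)
Lemma cylinder_nbhs (w : config) (U : set config) :
  nbhs w U -> exists F, cylinder w F `<=` U.
Proof.
pose G : set_system config := filter_from setT (cylinder w).
have FG : Filter G.
  apply: filter_from_filter => [|F1 F2 _ _]; first by exists [::].
  exists (F1 ++ F2) => // w' Hw; split=> u uF; apply: Hw;
    by rewrite mem_cat uF ?orbT.
have GW : G --> w.
  apply/cvg_sup => u A; rewrite nbhsE => -[B [[C oC <-] Cw] BA].
  exists [:: u] => // w' /(_ u); rewrite mem_head => /(_ isT) E.
  by apply: BA; rewrite /= E.
by move=> /GW [F _ FU]; exists F.
Qed.

Lemma orbit_closureP A (w : config) : orbit_closure A w ->
  forall F : seq (int * int), exists t, {in F, forall u, w u = (u - t \in A)}.
Proof.
move=> /(_ _ (nbhs_cylinder w _)) H F.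
have [_ [[t _ <-] Ht]] := H F.
by exists t => u /Ht.
Qed.

Lemma orbit_closure_translate (A : set (int * int)) t :
  orbit_closure A (translate t (charfun A)).
Proof. by apply: subset_closure; exists t. Qed.

Lemma orbit_closure_charfun A : orbit_closure A (charfun A).
Proof.
have := @orbit_closure_translate A 0; congr (orbit_closure A).
by apply: funext => u; rewrite /translate subr0.
Qed.

(** Continuity makes one coordinate of the image depend on a finite window. The window in question
    is that of [charfun A] at a coordinate [y] where its image is 1: equivariance then carries this
    1 to [x + y] for each return time [x]. *)
Lemma factor_returns A B : B !=set0 ->
  topological_factor (orbit_closure B) (orbit_closure A) ->
  exists F : seq (int * int), forall l : seq (int * int),
    {in l, forall x, {in F, forall u, (u + x \in A) = (u \in A)}} ->
    exists t, {in l, forall x, x + t \in B}.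
Proof.
move=> [b Bb] [phi [cont im equi]].
have loc w y : orbit_closure A w -> exists F : seq (int * int),
    forall w', orbit_closure A w' -> {in F, forall u, w' u = w u} ->
    phi w' y = phi w y.
  move=> Aw.
  have Hy := nbhs_cylinder (phi w) [:: y].
  have := cont w _ Hy; rewrite /nbhs /= -nbhs_subspace_in // => /cylinder_nbhs.
  move=> [F HF]; exists F => w' Aw' /HF /(_ Aw') /(_ y).
  by rewrite mem_head; apply.
have cA := @orbit_closure_charfun A.
have [w Aw Ew] : (phi @` orbit_closure A) (charfun B).
  by rewrite im; exact: orbit_closure_charfun.
have [F HF] := loc w b Aw.
have [s Hs] := orbit_closureP Aw F.
(* The translate of [A] by [s] agrees with [w] on the window of coordinate [b], so its image is 1 at
   [b]; by equivariance the image of [A] itself is 1 at [b - s]. *)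
pose y := b - s.
have phiAy : phi (charfun A) y = true.
  have <- : translate s (phi (charfun A)) b = phi (charfun A) y by [].
  rewrite -equi // HF; first by rewrite Ew /charfun; apply/mem_set.
    exact: orbit_closure_translate.
  by move=> u /Hs ->.
have [F' HF'] := loc _ y cA.
exists F' => l Hl.
have BF : orbit_closure B (phi (charfun A)).
  by rewrite -im; exists (charfun A).
have [t Ht] := orbit_closureP BF [seq x + y | x <- l].
exists (y - t) => x xl.
rewrite addrA -Ht; last by apply/mapP; exists x.
transitivity (phi (charfun A) y); last by rewrite phiAy.
rewrite -(HF' (translate (- x) (charfun A))).
- by rewrite equi // /translate opprK addrC.
- exact: orbit_closure_translate.
- by move=> u uF; rewrite /translate /charfun opprK; apply: Hl.
Qed.

(** * Arithmetic of the Gaussian integers *)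

Section Divides.
Variable R : comNzRingType.
Implicit Types d x y z : R.

Lemma divides_trans d x y : divides d x -> divides x y -> divides d y.
Proof. by move=> [a ->] [b ->]; exists (b * a); rewrite mulrA. Qed.

Lemma divides_mull d x y : divides d y -> divides d (x * y).
Proof. by move=> [a ->]; exists (x * a); rewrite mulrA. Qed.

Lemma dividesD d x y : divides d x -> divides d y -> divides d (x + y).
Proof. by move=> [a ->] [b ->]; exists (a + b); rewrite mulrDl. Qed.

Lemma dividesN d x : divides d x -> divides d (- x).
Proof. by move=> [a ->]; exists (- a); rewrite mulNr. Qed.

Lemma dividesB d x y : divides d x -> divides d y -> divides d (x - y).
Proof. by move=> dx /dividesN; exact: dividesD. Qed.

Lemma divides_addl d x y : divides d y -> divides d (x + y) -> divides d x.
Proof. by move=> dy dxy; rewrite -(addrK y x); exact: dividesB. Qed.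

Lemma divides_exp d x n : divides d x -> divides (d ^+ n) (x ^+ n).
Proof. by move=> [a ->]; exists (a ^+ n); rewrite exprMn. Qed.

Lemma prime_element_exp p x n : prime_element p -> divides p (x ^+ n) ->
  divides p x.
Proof.
move=> [_ p1 pM]; elim: n => [|n IH]; first by rewrite expr0.
by rewrite exprS => /pM[].
Qed.

End Divides.

Definition gnorm (z : gaussint) : int := gre z ^+ 2 + gim z ^+ 2.
Definition gconj (z : gaussint) : gaussint := Gauss (gre z) (- gim z).

Lemma greD x y : gre (x + y) = gre x + gre y. Proof. by []. Qed.
Lemma gimD x y : gim (x + y) = gim x + gim y. Proof. by []. Qed.
Lemma greN x : gre (- x) = - gre x. Proof. by []. Qed.
Lemma gimN x : gim (- x) = - gim x. Proof. by []. Qed.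
Lemma greM x y : gre (x * y) = gre x * gre y - gim x * gim y.
Proof. by []. Qed.
Lemma gimM x y : gim (x * y) = gre x * gim y + gim x * gre y.
Proof. by []. Qed.
Lemma gre_int n : gre n%:~R = n. Proof. by rewrite gauss_intr. Qed.
Lemma gim_int n : gim n%:~R = 0. Proof. by rewrite gauss_intr. Qed.

Definition gaussE := (greD, gimD, greN, gimN, greM, gimM, gre_int, gim_int).

Lemma gauss_ext (x y : gaussint) : gre x = gre y -> gim x = gim y -> x = y.
Proof. by case: x y => [a b] [c d] /= -> ->. Qed.

Lemma gnormM x y : gnorm (x * y) = gnorm x * gnorm y.
Proof. by rewrite /gnorm !gaussE; ring. Qed.

Lemma gnorm_ge0 z : 0 <= gnorm z.
Proof. by rewrite /gnorm addr_ge0 ?sqr_ge0. Qed.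

Lemma gnorm_eq0 z : (gnorm z == 0) = (z == 0).
Proof.
rewrite /gnorm paddr_eq0 ?sqr_ge0 // !sqrf_eq0.
apply/andP/eqP => [[/eqP a0 /eqP b0]|->]; last by [].
exact: gauss_ext.
Qed.

Lemma gnorm_gt0 z : (0 < gnorm z) = (z != 0).
Proof. by rewrite lt0r gnorm_ge0 andbT gnorm_eq0. Qed.

Lemma gnorm_int n : gnorm n%:~R = n ^+ 2.
Proof. by rewrite /gnorm !gaussE; ring. Qed.

Lemma mul_gconj z : z * gconj z = (gnorm z)%:~R.
Proof. by apply: gauss_ext; rewrite !gaussE /= /gnorm; ring. Qed.

Lemma gnorm_conj z : gnorm (gconj z) = gnorm z.
Proof. by rewrite /gnorm /= sqrrN. Qed.

Lemma divides_gnorm d : divides d (gnorm d)%:~R.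
Proof. by exists (gconj d); rewrite mulrC mul_gconj. Qed.

Lemma divides_int (n : int) z :
  divides n%:~R z <-> (n %| gre z)%Z /\ (n %| gim z)%Z.
Proof.
split=> [[a ->]|[/dvdzP[a Ea] /dvdzP[b Eb]]].
  by rewrite !gaussE !mulr0 subr0 add0r !dvdz_mull.
by exists (Gauss a b); apply: gauss_ext; rewrite !gaussE /= ?Ea ?Eb; ring.
Qed.

Lemma divides_int_int (m n : int) : (m %| n)%Z ->
  divides (m%:~R : gaussint) n%:~R.
Proof. by move=> mn; apply/divides_int; rewrite !gaussE dvdz0. Qed.

Lemma round_div (a n : int) : 0 < n -> exists k, 2 * `|a - k * n| <= n.
Proof.
(* The nearest integer to a/n, as the floor of a/n + 1/2. *)
move=> n0; exists ((2 * a + n) %/ (2 * n))%Z.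
have n20 : 2 * n != 0 by lia.
have := divz_eq (2 * a + n) (2 * n).
have := modz_ge0 (2 * a + n) n20.
have := ltz_pmod (2 * a + n) (_ : 0 < 2 * n).
move: (_ %/ _)%Z (_ %% _)%Z => k r; lia.
Qed.

(** Round both coordinates of the quotient z/d, computed as z times the conjugate of d over the norm
    of d. Each error is at most 1/2, so the remainder has at most half the norm of d. *)
Lemma gauss_euclid (z d : gaussint) : d != 0 ->
  exists w, gnorm (z - w * d) < gnorm d.
Proof.
rewrite -gnorm_gt0 => d0.
have [a Ha] := round_div (gre (z * gconj d)) d0.
have [b Hb] := round_div (gim (z * gconj d)) d0.
exists (Gauss a b).
have E : gnorm (z - Gauss a b * d) * gnorm d =
    (gre (z * gconj d) - a * gnorm d) ^+ 2 +
    (gim (z * gconj d) - b * gnorm d) ^+ 2.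
  by rewrite -[in LHS](gnorm_conj d) -gnormM /gnorm !gaussE /=; ring.
have sq x : 2 * `|x| <= gnorm d -> 4 * x ^+ 2 <= gnorm d ^+ 2.
  by move=> Hx; rewrite -(real_normK (num_real x)) expr2 [leRHS]expr2; nia.
rewrite -(ltr_pM2r d0) E -expr2.
have := sq _ Ha; have := sq _ Hb; have : 0 < gnorm d ^+ 2 by rewrite exprn_gt0.
lia.
Qed.

(* [a + b i |-> a + b c] is the ring homomorphism from Z[i] to Z/q sending i to
   a square root [c] of -1; an element of least norm generates its kernel. *)
Lemma prime_element_split (q : nat) (c : int) : prime q ->
  (q %| c ^+ 2 + 1)%Z ->
  exists g, prime_element g /\ forall z, divides g z <-> (q %| gre z + gim z * c)%Z.
Proof.
move=> pq qc.
pose I z := (q %| gre z + gim z * c)%Z.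
have IM w z : I z -> I (w * z).
  move=> Iz; rewrite /I !gaussE.
  rewrite [X in X \in _](_ : _ = (gre w + gim w * c) * (gre z + gim z * c)
    - (gim w * gim z) * (c ^+ 2 + 1)); last by ring.
  by rewrite rpredB // dvdz_mull.
have IB w z : I w -> I z -> I (w - z).
  move=> Iw Iz; rewrite /I !gaussE.
  rewrite [X in X \in _](_ : _ = (gre w + gim w * c) - (gre z + gim z * c));
    last by ring.
  by rewrite rpredB.
pose P n := `[< exists z, [/\ I z, z != 0 & gnorm z = n%:Z] >].
have exP : exists n, P n.
  exists `|gnorm q%:Z%:~R|%N; apply/asboolP; exists q%:Z%:~R.
  split; first by rewrite /I !gaussE mul0r addr0 dvdzz.
  - by rewrite -gnorm_gt0 gnorm_int exprn_gt0 // ltz_nat prime_gt0.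
  - by rewrite gez0_abs // gnorm_ge0.
have [n /asboolP[g [Ig g0 Eg]] minn] := ex_minnP exP.
have gI z : divides g z <-> I z.
  split=> [[a ->]|Iz]; first exact: IM.
  have [w] := gauss_euclid z g0; set r := z - w * g => Hw.
  have [/eqP|r0] := eqVneq r 0; first by rewrite subr_eq0 => /eqP ->; exists w.
  have /minn : P `|gnorm r|%N.
    apply/asboolP; exists r; split => //; first exact/IB/IM.
    by rewrite gez0_abs // gnorm_ge0.
  by rewrite -lez_nat gez0_abs ?gnorm_ge0 // -Eg leNgt Hw.
exists g; split => //; split => //.
  move/gI; rewrite /I mul0r addr0 dvdzE absz1 /= dvdn1 => /eqP q1.
  by rewrite q1 in pq.
move=> a b /gI; rewrite /I !gaussE => H.
suff : (q %| (gre a + gim a * c) * (gre b + gim b * c))%Z.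
  rewrite dvdzE abszM Euclid_dvdM // => /orP[] ?; [left|right];
    by apply/gI; rewrite /I dvdzE.
rewrite [X in X \in _](_ : _ = gre a * gre b - gim a * gim b +
  (gre a * gim b + gim a * gre b) * c + gim a * gim b * (c ^+ 2 + 1));
  last by ring.
by rewrite rpredD // dvdz_mull.
Qed.

(** * Avoiding residue classes *)

(** In the applications [Z] is an ideal, seen as a set periodic modulo n. One return time for each r
    modulo n suffices, which makes the list finite: whatever [t] shifts all of them into [B], the
    one for r congruent to -t lands in [Z]. *)
Lemma no_factor A B : B !=set0 ->
  (forall F : seq (int * int), exists (n : nat) (Z : set (int * int)),
    [/\ (0 < n)%N,
        forall x y, Z x -> (n %| (y - x).1)%Z -> (n %| (y - x).2)%Z -> Z y,
        forall x, Z x -> ~ B x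
      & forall r, exists x, Z (x - r) /\
          {in F, forall u, (u + x \in A) = (u \in A)}]) ->
  ~ topological_factor (orbit_closure B) (orbit_closure A).
Proof.
move=> B0 H /(factor_returns B0)[F HF].
have [n [Z [n0 Zn ZB /choice[f Hf]]]] := H F.
have [|t Ht] := HF [seq f (Posz i, Posz j) | i <- iota 0 n, j <- iota 0 n].
  by move=> x /allpairsP[[i j] /= [_ _ ->]]; case: (Hf (Posz i, Posz j)).
have nz : Posz n != 0 by rewrite eqz_nat -lt0n.
have rmod (s : int) : exists2 k : nat, (k < n)%N & (n %| s + k%:Z)%Z.
  exists `|(- s %% n)%Z|%N.
    by rewrite -ltz_nat gez0_abs ?modz_ge0 // ltz_pmod.
  rewrite gez0_abs ?modz_ge0 // {1}(_ : s = - - s); last by rewrite opprK.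
  by rewrite {1}(divz_eq (- s) n) opprD addrNK rpredN dvdz_mull.
have [i ilt Hi] := rmod t.1; have [j jlt Hj] := rmod t.2.
pose r := (Posz i, Posz j).
have [Zr _] := Hf r.
apply: (ZB (f r + t)).
  have E : f r + t - (f r - r) = t + r.
    by rewrite opprB [r - _]addrC addrACA subrr add0r.
  by apply: (Zn _ _ Zr); rewrite E.
apply/set_mem/Ht/allpairsP; exists (i, j); split => //;
by rewrite mem_iota.
Qed.

(** Pigeonhole: each e excludes at most one k among 0, ..., p - 1, and there are fewer than p values
    e. *)
Lemma avoid_residues (d M a : int) (p : nat) (es : seq int) :
  (forall k, (d %| M * k)%Z -> (p %| k)%Z) -> (size es < p)%N ->
  exists k, {in es, forall e, ~~ (d %| a + M * k + e)%Z}.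
Proof.
move=> dM sp; apply: contrapT => /forallNP H.
have Hk (k : int) : has (fun e => d %| a + M * k + e)%Z es.
  apply/negPn/negP => /hasPn Hk; exact: (H k).
pose f (k : 'I_p) := Ordinal (etrans (esym (has_find _ _)) (Hk k)).
suff /leq_card : injective f by rewrite !card_ord leqNgt sp.
move=> k l /(congr1 val) /= E.
have Hl := nth_find 0 (Hk k); have := nth_find 0 (Hk l); rewrite -E /=.
move: (nth 0 es _) Hl => e Hl Hk'.
have /dM : (d %| M * (k%:Z - l%:Z))%Z.
  rewrite [X in X \in _](_ : _ = (a + M * k%:Z + e) - (a + M * l%:Z + e));
    last by ring.
  by rewrite rpredB.
move=> /dvdzP[c Ec]; apply: val_inj => /=.
move: Ec; have := ltn_ord k; have := ltn_ord l.
have [->|[c1|c1]] : c = 0 \/ 1 <= c \/ c <= -1 by lia.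
- by lia.
- by nia.
- by nia.
Qed.

(** Chinese remaindering one prime at a time: the pigeonhole fixes x modulo p, and the other primes
    are treated with the modulus M p. *)
Lemma avoid_primes (M a : int) (ps : seq nat) (es : seq int) :
  uniq ps ->
  {in ps, forall p, [/\ prime p, coprimez M p & (size es < p)%N]} ->
  exists x, (M %| x - a)%Z /\
    {in ps & es, forall (p : nat) (e : int), ~~ (p %| x + e)%Z}.
Proof.
elim: ps M a => [|p ps IH] M a /=; first by exists a; rewrite subrr dvdz0.
move=> /andP[pps ups] H.
have [pp cMp sp] := H p (mem_head _ _).
have [k Hk] : exists k, {in es, forall e, ~~ (p %| a + M * k + e)%Z}.
  apply: (@avoid_residues p M a p) => // k.
  by rewrite Gauss_dvdzr // coprimez_sym.
have [|x [Mx Hx]] := IH (M * p%:Z) (a + M * k) ups.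
  move=> q qps; have [|pq cMq sq] := H q; first by rewrite inE qps orbT.
  split => //; rewrite coprimezMl cMq coprimezE /= prime_coprime //.
  by rewrite dvdn_prime2 //; apply: contraNneq pps => ->.
exists x; split.
  rewrite (_ : x - a = (x - (a + M * k)) + M * k); last by ring.
  by rewrite rpredD ?dvdz_mulr // (dvdz_trans _ Mx) ?dvdz_mulr.
move=> q e; rewrite inE => /orP[/eqP->|]; last exact: Hx.
move=> /Hk; apply: contra => px.
rewrite (_ : _ + e = (x + e) - (x - (a + M * k))); last by ring.
by rewrite rpredB // (dvdz_trans _ Mx) ?dvdz_mull.
Qed.

Lemma visibleP u : (u \in visible_points) <->
  (forall p, prime p -> ~~ ((p %| u.1)%Z && (p %| u.2)%Z)).
Proof.
rewrite inE /visible_points /=; split=> [u1 p pp|H].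
  rewrite -dvdz_gcd u1 dvdzE /= dvdn1.
  by apply: contraL pp => /eqP ->.
apply/eqP/contraT => g1.
have g1' : gcdn `|u.1| `|u.2| != 1%N.
  by apply: contraNneq g1 => g1; rewrite /gcdz g1.
(* The gcd vanishes only at the origin, where the prime 2 already divides both coordinates. *)
have [g0|g0] := posnP (gcdn `|u.1| `|u.2|).
  by have := H 2%N isT; rewrite !dvdzE -dvdn_gcd g0 dvdn0.
have := H _ (pdiv_prime (_ : 1 < gcdn `|u.1| `|u.2|)%N).
rewrite !dvdzE -dvdn_gcd pdiv_dvd; apply.
by rewrite ltn_neqAle eq_sym g1'.
Qed.

(** A prime factor q of (b+2)!^2 + 1 exceeds b + 2, and -1 is a square modulo q. The last clause
    makes i congruent to the integer c modulo g^2, so integers represent all classes modulo g^2. *)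
Lemma split_prime (b : nat) : exists (q : nat) (g : gaussint) (c : int),
  [/\ prime q, (b < q)%N, prime_element g, divides (g ^+ 2) (q ^ 2)%:Z%:~R
    & forall z, ((q ^ 2)%N %| gre z + gim z * c)%Z -> divides (g ^+ 2) z].
Proof.
pose c : nat := b.+2`!.
pose q := pdiv (c ^ 2).+1.
have c0 : (0 < c)%N by exact: fact_gt0.
have pq : prime q by apply: pdiv_prime; rewrite ltnS expn_gt0 c0.
have qc : (q %| c%:Z ^+ 2 + 1)%Z.
  by rewrite dvdzE /= -[X in (_ %| X)%N]/(c ^ 2 + 1)%N addn1 pdiv_dvd.
have qNc : ~~ (q %| c)%N.
  apply: contraL pq => qc'; have : (q %| 1)%N.
    by rewrite -(dvdn_addr 1 (dvdn_exp (isT : 0 < 2)%N qc')) addn1 pdiv_dvd.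
  by rewrite dvdn1 => /eqP ->.
have bq : (b.+2 < q)%N.
  by rewrite ltnNge; apply: contra qNc => qb; rewrite dvdn_fact // prime_gt0.
have [g [pg Hg]] := prime_element_split pq qc.
have gq : divides (g ^+ 2) (q ^ 2)%:Z%:~R.
  rewrite (_ : _%:~R = q%:Z%:~R ^+ 2); last by rewrite -rmorphXn.
  by apply: divides_exp; apply/Hg; rewrite !gaussE mul0r addr0 dvdzz.
have cop : coprimez (2 * c%:Z) (q ^ 2)%N.
  rewrite coprimezE abszM /= coprimeXr // coprime_sym prime_coprime //.
  by rewrite Euclid_dvdM // negb_or qNc andbT gtnNdvd //; lia.
have [e [f]] := Bezoutz (2 * c%:Z) (q ^ 2)%N; rewrite (eqP cop) => E.
(* One Newton step lifts the square root of -1 from modulus q to q^2: it replaces c by (c^2 -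
   1)/(2c). *)
exists q, g, (e * (c%:Z ^+ 2 - 1)); split => //; first lia.
move=> z /dvdzP[k Ek].
have gc : divides (g ^+ 2) ((Gauss (- c%:Z) 1) ^+ 2).
  by apply: divides_exp; apply/Hg; rewrite /= mul1r addNr dvdz0.
(* [2 c i = c^2 - 1 - (i - c)^2], and [2 c] is inverted by [e] modulo [q^2] *)
have -> : z = (Gauss k (gim z * f)) * (q ^ 2)%:Z%:~R
   - (gim z * e)%:~R * (Gauss (- c%:Z) 1) ^+ 2.
  apply: gauss_ext; rewrite !gaussE /=.
    by apply/(addIr (gim z * (e * (c%:Z ^+ 2 - 1)))); rewrite Ek; ring.
  by rewrite -[LHS]mulr1 -[in LHS]E; ring.
by apply: dividesB; exact: divides_mull.
Qed.

(** * Return times of the visible points *)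

Lemma prime_dvdn_fact p n : prime p -> (p %| n`!)%N = (p <= n)%N.
Proof.
move=> pp; apply/idP/idP => [|pn]; last by rewrite dvdn_fact // prime_gt0.
elim: n => [|n IH]; first by rewrite dvdn1 => /eqP p1; rewrite p1 in pp.
rewrite factS Euclid_dvdM // => /orP[/dvdn_leq->//|/IH pn]; exact: leqW.
Qed.

Lemma seq_bounded (T : eqType) (f : T -> nat) (s : seq T) :
  exists b, {in s, forall x, (f x <= b)%N}.
Proof. by exists (\max_(x <- s) f x)%N => x xs; exact: leq_bigmax_seq. Qed.

(** First [x2] is chosen divisible by b! with all [x2 + u.2] prime to q; then [x1] is chosen
    divisible by b!, in the class modulo q^2 forced by r, and avoiding -u.1 modulo the remaining
    primes that divide some [x2 + u.2]. Primes up to b do not notice x, and no larger prime divides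
    both coordinates of u + x. *)
Lemma visible_returns (F : seq (int * int)) (b q : nat) (c : int) r :
  (1 < b)%N -> (size F <= b)%N ->
  {in F, forall u, (`|u.1| <= b)%N /\ (`|u.2| <= b)%N} ->
  prime q -> (b < q)%N ->
  exists x : int * int,
    ((q ^ 2)%N %| (x - r).1 + (x - r).2 * c)%Z /\
    {in F, forall u, (u + x \in visible_points) = (u \in visible_points)}.
Proof.
move=> b1 sF Fb pq bq.
pose K := b`!.
have cKq : coprime K q.
  by rewrite coprime_sym prime_coprime // prime_dvdn_fact // -ltnNge.
have [x2 [Kx2 Hx2]] : exists x2, (K %| x2 - 0)%Z /\
    {in [:: q] & [seq u.2 | u <- F],
      forall (p : nat) (e : int), ~~ (p %| x2 + e)%Z}.
  apply: (@avoid_primes K 0 [:: q]) => // p; rewrite inE => /eqP ->.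
  by split; rewrite // size_map (leq_ltn_trans sF).
rewrite subr0 in Kx2.
have {}Hx2 u : u \in F -> ~~ (q %| x2 + u.2)%Z.
  by move=> uF; apply: Hx2; rewrite ?mem_head ?map_f.
have [a [Ka qa]] : exists a, (K %| a)%Z /\
    ((q ^ 2)%N %| a - (r.1 + r.2 * c - x2 * c))%Z.
  have cop : coprimez K (q ^ 2)%N by rewrite coprimezE coprimeXr.
  exists (zchinese K (q ^ 2)%N 0 (r.1 + r.2 * c - x2 * c)).
  have := zchinese_modl cop 0 (r.1 + r.2 * c - x2 * c).
  have := zchinese_modr cop 0 (r.1 + r.2 * c - x2 * c).
  move/eqP; rewrite eqz_mod_dvd => -> /eqP.
  by rewrite eqz_mod_dvd subr0.
(* Not being divisible by q keeps every factor nonzero, so only finitely many primes constrain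
   [x1]. *)
pose P := absz (\prod_(u <- F) (x2 + u.2)).
have P0 : (0 < P)%N.
  rewrite absz_gt0 prodf_seq_neq0; apply/allP => u uF /=.
  by apply: contraNneq (Hx2 u uF) => ->; rewrite dvdz0.
have [|x1 [Mx1 Hx1]] := @avoid_primes (K * q ^ 2)%N a
    [seq p <- primes P | ~~ (p %| K * q)%N] [seq u.1 | u <- F]
    (filter_uniq _ (primes_uniq _)).
  move=> p; rewrite mem_filter mem_primes => /andP[pKq /and3P[pp _ _]].
  move: pKq; rewrite Euclid_dvdM // negb_or => /andP[pK pNq].
  split => //.
    rewrite coprimezE coprime_sym prime_coprime //= Euclid_dvdM //.
    by rewrite negb_or pK Euclid_dvdX // andbT.
  by rewrite size_map (leq_ltn_trans sF) // ltnNge -(prime_dvdn_fact _ pp).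
have Kx1 : (K %| x1)%Z.
  by rewrite -(subrK a x1) rpredD // (dvdz_trans _ Mx1) // PoszM dvdz_mulr.
exists (x1, x2); split.
  rewrite /= [X in X \in _](_ : _ = (x1 - a) + (a - (r.1 + r.2 * c - x2 * c)));
    last by ring.
  by rewrite rpredD // (dvdz_trans _ Mx1) // PoszM dvdz_mull.
move=> u uF; have [u1b u2b] := Fb u uF.
have dvdK p : (p %| K)%N -> (p %| (u + (x1, x2)).1)%Z && (p %| (u + (x1, x2)).2)%Z
    = (p %| u.1)%Z && (p %| u.2)%Z.
  move=> pK; have {}pK : (p %| K%:Z)%Z by [].
  by rewrite !rpredDr // (dvdz_trans pK).
apply/idP/idP => /visibleP H; apply/visibleP => p pp; apply/negP => pu.
- have [pb|bp] := leqP p b.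
    by have /negP := H p pp; rewrite dvdK // prime_dvdn_fact.
  (* A common prime factor above b forces u = 0; then 2 divides both coordinates of u + x, against
     visibility. *)
  have small (v : int) : (`|v| <= b)%N -> (p %| v)%Z -> v = 0.
    move=> vb; rewrite dvdzE /= => pv; apply/eqP/contraT => v0.
    by have := dvdn_leq (_ : 0 < `|v|)%N pv; rewrite absz_gt0 => /(_ v0);
      rewrite leqNgt (leq_ltn_trans vb bp).
  case/andP: pu => /(small _ u1b) u10 /(small _ u2b) u20.
  have /negP := H 2%N isT; apply.
  by rewrite dvdK ?prime_dvdn_fact // u10 u20 !dvdz0.
- have [pK|pNK] := boolP (p %| K)%N.
    by have /negP := H p pp; rewrite -dvdK.
  case/andP: pu => /=; rewrite ![u.1 + _]addrC ![u.2 + _]addrC => p1 p2.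
  have pq' : p != q by apply: contraTneq p2 => ->; exact: Hx2.
  have pps : p \in [seq p <- primes P | ~~ (p %| K * q)%N].
    rewrite mem_filter Euclid_dvdM // negb_or pNK dvdn_prime2 // pq'.
    rewrite mem_primes pp P0 /= /P.
    have : (p %| \prod_(u <- F) (x2 + u.2))%Z.
      by rewrite (big_rem u) //= dvdz_mulr.
    by rewrite dvdzE.
  by have := Hx1 p u.1 pps (map_f _ uF); rewrite p1.
Qed.

Lemma visible_points_neq0 : visible_points !=set0.
Proof. by exists (1, 0). Qed.

Lemma squarefree_gauss_neq0 : squarefree_gauss !=set0.
Proof.
exists (1, 0); split=> // p [p0 p1 pM] [a Ea]; apply: p1; exists (a * p).
by rewrite -mulrA -expr2 -Ea.
Qed.

Lemma X_G_not_factor_of_X_V : ~ topological_factor X_G X_V.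
Proof.
apply: no_factor squarefree_gauss_neq0 _ => F.
have [b1 Hb1] := seq_bounded (fun u : int * int => `|u.1|%N) F.
have [b2 Hb2] := seq_bounded (fun u : int * int => `|u.2|%N) F.
have [q [g [c [pq bq pg gq gc]]]] := split_prime (2 + size F + b1 + b2).
(* The ideal of g^2 contains q^2, so it is a union of classes modulo q^2. *)
exists (q ^ 2)%N, [set x | divides (g ^+ 2) (Gauss x.1 x.2)].
split.
- by rewrite expn_gt0 prime_gt0.
- move=> x y /= gx q1 q2.
  have -> : Gauss y.1 y.2 = Gauss x.1 x.2 + Gauss (y - x).1 (y - x).2.
    by apply: gauss_ext; rewrite !gaussE /=; ring.
  by apply: dividesD => //; apply: divides_trans gq _; apply/divides_int.
- by move=> x gx [_ /(_ g pg)].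
- move=> r; have [|||x [Hx1 Hx2]] := @visible_returns F _ q c r _ _ _ pq bq.
  + by lia.
  + by lia.
  + by move=> u uF; have := Hb1 u uF; have := Hb2 u uF => /=; lia.
  + by exists x; split => //; exact: gc.
Qed.

(** * A square-free sieve in the Gaussian integers *)

Lemma card_le_sum_cover (T : finType) (I : Type) (r : seq I) (P : I -> pred T) :
  (forall w, has (P^~ w) r) -> (#|T| <= \sum_(i <- r) #|P i|)%N.
Proof.
move=> cov.
suff H : (#|[pred w | has (P^~ w) r]| <= \sum_(i <- r) #|P i|)%N.
  apply: leq_trans H; apply: subset_leq_card.
  by apply/fintype.subsetP => w _; exact: cov.
elim: r {cov} => [|i r IH]; first by rewrite big_nil leqn0; apply/eqP/eq_card0.
rewrite big_cons; apply: leq_trans (leq_add (leqnn _) IH).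
by rewrite -cardUI; apply: leq_trans (leq_addr _ _); apply: subset_leq_card;
  apply/fintype.subsetP => w; rewrite !inE.
Qed.

Lemma gauss_mulIf (x y z : gaussint) : z != 0 -> x * z = y * z -> x = y.
Proof.
move=> z0 /eqP; rewrite -subr_eq0 -mulrBl -gnorm_eq0 gnormM mulf_eq0.
by rewrite !gnorm_eq0 (negbTE z0) orbF subr_eq0 => /eqP.
Qed.

Lemma gnorm_le_divides (d x : gaussint) : x != 0 -> divides d x ->
  gnorm d <= gnorm x.
Proof.
move=> x0 [a Ea]; have a0 : a != 0.
  by apply: contraNneq x0 => a0; rewrite Ea a0 mul0r.
by rewrite Ea gnormM ler_peMl ?gnorm_ge0 // -gtz0_ge1 gnorm_gt0.
Qed.

Lemma prime_element_sqr_cancel (g n d : gaussint) : prime_element g ->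
  ~ divides g n -> divides (g ^+ 2) (n * d) -> divides (g ^+ 2) d.
Proof.
move=> [g0 _ gM] gn [a Ea].
have [|//|[c Ec]] := gM n d; first by exists (a * g); rewrite Ea expr2 mulrA.
have [|//|[e Ee]] := gM n c; last by exists e; rewrite Ec Ee -mulrA.
by exists a; apply: (gauss_mulIf g0); rewrite -mulrA -Ec Ea expr2 mulrA.
Qed.

(** A power of i rotates g into the sector where the imaginary part is at most the real part m in
    absolute value; b is their sum, between 0 and 2m. Squares of these units are 1 or -1, so g^2
    changes at most by sign. *)
Lemma gauss_associate (g : gaussint) : exists m b : nat,
  let g' := Gauss m%:Z (b%:Z - m%:Z) in
  [/\ (b < m.*2.+1)%N, gnorm g' = gnorm g
    & forall z, divides (g ^+ 2) z <-> divides (g' ^+ 2) z].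
Proof.
have [u [u2 nu [x0 xy]]] : exists u : gaussint, [/\ u ^+ 2 = 1 \/ u ^+ 2 = -1,
    gnorm u = 1 & 0 <= gre (u * g) /\ `|gim (u * g)| <= gre (u * g)].
  have [xy|xy] := leP `|gim g| `|gre g|; have [s0|s0] := leP 0 (gre g);
    have [t0|t0] := leP 0 (gim g).
  - by exists 1; rewrite mul1r; split=> //; [left|lia].
  - by exists 1; rewrite mul1r; split=> //; [left|lia].
  - by exists (-1); rewrite mulN1r !gaussE; split=> //; [left|lia].
  - by exists (-1); rewrite mulN1r !gaussE; split=> //; [left|lia].
  - by exists (Gauss 0 (-1)); rewrite !gaussE /=; split=> //; [right|lia].
  - by exists (Gauss 0 1); rewrite !gaussE /=; split=> //; [right|lia].
  - by exists (Gauss 0 (-1)); rewrite !gaussE /=; split=> //; [right|lia].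
  - by exists (Gauss 0 1); rewrite !gaussE /=; split=> //; [right|lia].
case Ev: (u * g) x0 xy => [x y] /= x0 xy.
exists (absz x), (absz (y + x)) => /=.
have -> : Gauss (absz x)%:Z ((absz (y + x))%:Z - (absz x)%:Z) = u * g.
  by rewrite Ev; congr Gauss; lia.
split; [lia | by rewrite gnormM nu mul1r |].
move=> z; rewrite exprMn; split=> -[a ->]; last first.
  by exists (a * u ^+ 2); rewrite mulrA.
case: u2 => ->; first by exists a; rewrite mul1r.
by exists (- a); rewrite mulN1r mulrNN.
Qed.

Definition box_point L (w : 'I_L * 'I_L) : gaussint :=
  Gauss (nat_of_ord w.1)%:Z (nat_of_ord w.2)%:Z.

Lemma divn_eq_dist (h i j : nat) : (0 < h)%N -> (i %/ h = j %/ h)%N ->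
  `|i%:Z - j%:Z| < h%:Z.
Proof.
move=> h0 E; rewrite (divn_eq i h) (divn_eq j h) E.
have := ltn_pmod i h0; have := ltn_pmod j h0; lia.
Qed.

(* Distinct points congruent modulo [q] differ by a vector of norm at least [m^4],
   so each square cell of side [m^2 / 2 + 1] contains at most one of them. *)
Lemma box_separated (L m : nat) (q : gaussint) (P : pred ('I_L * 'I_L)) :
  m%:Z ^+ 4 <= gnorm q -> (0 < m)%N ->
  {in P &, forall v w, divides q (box_point v - box_point w)} ->
  (#|P| <= (L %/ (m ^ 2 %/ 2).+1).+1 ^ 2)%N.
Proof.
move=> mq m0 HP; set h := (m ^ 2 %/ 2).+1.
have h2 : 2 * (h%:Z - 1) <= m%:Z ^+ 2 by rewrite /h; lia.
have h0 : (0 < h)%N by [].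
clearbody h.
have bnd (i : 'I_L) : (i %/ h < (L %/ h).+1)%N.
  by rewrite ltnS leq_div2r // ltnW.
pose f (w : 'I_L * 'I_L) := (Ordinal (bnd w.1), Ordinal (bnd w.2)).
have inj : {in P &, injective f}.
  move=> v w Pv Pw [E1 E2].
  have [/eqP|d0] := eqVneq (box_point v - box_point w) 0.
    rewrite subr_eq0 => /eqP[/val_inj e1 /val_inj e2].
    by rewrite [v]surjective_pairing [w]surjective_pairing e1 e2.
  have := gnorm_le_divides d0 (HP _ _ Pv Pw).
  have sq (i j : 'I_L) : (i %/ h = j %/ h)%N ->
      4 * (i%:Z - j%:Z) ^+ 2 <= m%:Z ^+ 4.
    move=> /(divn_eq_dist h0) ijh; apply: le_trans (_ : (2 * (h%:Z - 1)) ^+ 2 <= _).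
      rewrite exprMn -(real_normK (num_real (i%:Z - j%:Z))) ler_pM2l //.
      by rewrite ler_sqr ?nnegrE //; lia.
    by rewrite (exprM _ 2 2) ler_sqr ?nnegrE ?exprn_ge0 //; lia.
  have := sq _ _ E1; have := sq _ _ E2.
  move=> c1 c2 dq; have := le_trans mq dq.
  have : 0 < m%:Z ^+ 4 by rewrite exprn_gt0.
  rewrite /gnorm !gaussE /=; clear -c1 c2; lia.
have -> : ((L %/ h).+1 ^ 2 = #|{: 'I_(L %/ h).+1 * 'I_(L %/ h).+1}|)%N.
  by rewrite card_prod !card_ord mulnn.
exact: leq_card_in inj.
Qed.

(** The quotient q in the m-th term is at most 2L/m^2, so that term is at most 6m q^2 + 6m, hence at
    most 24 L^2/m^3 + 6m. Bounding 1/m^3 by 1/(m-1) - 1/m makes the sum telescope. *)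
Lemma sieve_sum (R : realFieldType) (L m0 M : nat) : (0 < m0)%N -> (m0 <= M)%N ->
  (\sum_(m0.+1 <= m < M.+1)
     (m.*2.+1 * (L %/ (m ^ 2 %/ 2).+1).+1 ^ 2)%N)%:R
  <= 24%:R * L%:R ^+ 2 * (m0%:R^-1 - M%:R^-1) + 6%:R * M%:R ^+ 2 :> R.
Proof.
move=> m00; elim: M => [|M IH]; first by rewrite leqNgt m00.
rewrite leq_eqVlt => /orP[/eqP ->|].
  by rewrite big_geq // subrr mulr0 add0r mulr_ge0 // exprn_ge0.
rewrite ltnS => mM; rewrite big_nat_recr //= natrD.
have M0 : (0 < M)%N by exact: leq_trans mM.
set q := (L %/ (M.+1 ^ 2 %/ 2).+1)%N.
have qM : (q * M.+1 ^ 2 <= 2 * L)%N.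
  have := leq_trunc_div L (M.+1 ^ 2 %/ 2).+1; rewrite -/q.
  have : (M.+1 ^ 2 <= 2 * (M.+1 ^ 2 %/ 2).+1)%N.
    by have := divn_eq (M.+1 ^ 2) 2; have := ltn_mod (M.+1 ^ 2) 2; lia.
  by move: (M.+1 ^ 2)%N (_ %/ 2).+1 => x h; nia.
have term : ((M.+1).*2.+1 * q.+1 ^ 2)%N%:R <=
    24%:R * L%:R ^+ 2 * (M%:R^-1 - M.+1%:R^-1) + 6%:R * M.+1%:R :> R.
  apply: (@le_trans _ _ (6%:R * M.+1%:R * q%:R ^+ 2 + 6%:R * M.+1%:R)).
    rewrite -!natrX -!natrM -!natrD ler_nat.
    have : (q.+1 ^ 2 <= 2 * q ^ 2 + 2)%N by nia.
    have : ((M.+1).*2.+1 <= 3 * M.+1)%N by lia.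
    by move: (_.*2.+1) (q.+1 ^ 2)%N (q ^ 2)%N => x y z; nia.
  rewrite lerD2r.
  have {}qM : q%:R * M.+1%:R ^+ 2 <= 2 * L%:R :> R.
    by rewrite -natrX -!natrM ler_nat.
  have x0 : 0 < M%:R :> R by rewrite ltr0n.
  rewrite -(natr1 M) in qM *.
  move: (M%:R : R) (q%:R : R) (L%:R : R) x0 qM (ler0n R q).
  move=> x y l x0 xy y0.
  have -> : x^-1 - (x + 1)^-1 = (x * (x + 1))^-1.
    by field; rewrite !gt_eqF //; lra.
  rewrite ler_pdivlMr; last by nra.
  have : (y * (x + 1) ^+ 2) ^+ 2 <= (2 * l) ^+ 2.
    have y1 : 0 <= y * (x + 1) ^+ 2 by rewrite mulr_ge0 ?sqr_ge0.
    have l1 := le_trans y1 xy.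
    by rewrite ler_sqr.
  have : 0 <= y ^+ 2 * (x + 1) ^+ 3 by rewrite mulr_ge0 ?exprn_ge0 //; lra.
  nra.
apply: le_trans (lerD (IH mM) term) _; rewrite -(natr1 M).
have : 0 < M%:R :> R by rewrite ltr0n.
move: (M%:R : R) (m0%:R^-1 : R) (L%:R : R) => x a l x0.
by move: (x^-1) ((x + 1)^-1) => b c; nra.
Qed.

Lemma sum_const_iota (n c : nat) : (\sum_(b <- iota 0 n) c = n * c)%N.
Proof. by rewrite big_const_seq iter_addn_0 count_predT size_iota mulnC. Qed.

(** The main term 24 k L^2/m is below L^2/2 because 48 k < m; the error 6 k M^2 = 24 k C^2 L is at
    most l L/2, hence at most L^2/2. Together they do not reach L^2. *)
Lemma sieve_contradiction (R : realFieldType) (X L k m M C l : R) :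
  X <= 24%:R * L ^+ 2 * (m^-1 - M^-1) + 6%:R * M ^+ 2 ->
  L * L <= X * k -> 48%:R * k < m -> 48%:R * k * C ^+ 2 <= l ->
  M = 2%:R * C * l -> L = l ^+ 2 -> 1 <= l -> 0 < m -> 0 <= M^-1 ->
  0 <= X -> 0 <= k -> False.
Proof.
move=> HX HL Sm lC EM EL l1 m0 M0 X0 k0.
have L0 : 1 <= L by rewrite EL; nra.
have km : 24%:R * k * m^-1 < 2%:R^-1 by rewrite ltr_pdivrMr //; lra.
have : L * L <= (24%:R * L ^+ 2 * m^-1 + 6%:R * M ^+ 2) * k.
  apply: le_trans HL _; apply: ler_wpM2r => //; apply: le_trans HX _.
  rewrite lerD2r; apply: ler_wpM2l; first by rewrite mulr_ge0 ?sqr_ge0.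
  by rewrite lerBlDr lerDl.
have -> : (24%:R * L ^+ 2 * m^-1 + 6%:R * M ^+ 2) * k =
    L ^+ 2 * (24%:R * k * m^-1) + (48%:R * k * C ^+ 2) * (L / 2%:R).
  by rewrite EM [X in _ = _ + _ * (X / _)]EL; move: (m^-1) => i; field.
have : L ^+ 2 * (24%:R * k * m^-1) < L ^+ 2 * 2%:R^-1.
  by rewrite ltr_pM2l // exprn_gt0 //; lra.
have : (48%:R * k * C ^+ 2) * (L / 2%:R) <= L ^+ 2 * 2%:R^-1.
  have lL : l <= L by rewrite EL; nra.
  rewrite mulrA expr2 ler_pM2r; last by rewrite invr_gt0.
  by apply: ler_wpM2r; [lra | exact: le_trans lL].
by move: (m^-1) => i; lra.
Qed.

(* The box has side [L = l^2]. Up to a unit, a Gaussian prime [g] whose square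
   divides some [s + N w] with [w] in the box is [m + (b - m) i] with [b <= 2 m]
   and [m0 < m <= M], [M] being of order [l]; the points of the box lost to all
   such [g] number at most [#|S|] times a small multiple of [L^2] plus O([M^2]). *)
Lemma gauss_sieve (S : seq gaussint) (N m0 : nat) :
  (0 < N)%N -> (48 * size S < m0)%N ->
  (forall s w, s \in S -> s + N%:Z%:~R * w != 0) ->
  exists w, forall s g, s \in S -> prime_element g ->
    ~ divides g N%:Z%:~R -> 2 * m0%:Z ^+ 2 < gnorm g ->
    ~ divides (g ^+ 2) (s + N%:Z%:~R * w).
Proof.
move=> N0 Sm0 sN0; apply: contrapT => /forallNP H.
have [h1 Hh1] := seq_bounded (fun s => absz (gre s)) S.
have [h2 Hh2] := seq_bounded (fun s => absz (gim s)) S.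
have [C [C0 C1 C2]] : exists C, [/\ (0 < C)%N, (h1 + N <= C)%N & (h2 + N <= C)%N].
  by exists (h1 + h2 + N)%N; split; lia.
(* The first bound on [l] absorbs the O(M^2) error of the sieve; the second ensures [m0 <= M]. *)
have [l [l0 lC lm]] : exists l, [/\ (0 < l)%N,
    (48 * size S * C ^ 2 <= l)%N & (m0 <= l)%N].
  by exists (48 * size S * C ^ 2 + m0).+1; split=> //; apply: leqW;
    rewrite ?leq_addr ?leq_addl.
have [L EL] : exists L, L = (l ^ 2)%N by exists (l ^ 2)%N.
have [M EM] : exists M, M = (2 * C * l)%N by exists (2 * C * l)%N.
pose G (m b : nat) := Gauss m%:Z (b%:Z - m%:Z) ^+ 2.
(* The second condition, that N cancels modulo [G], replaces the primality of g: it makes any two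
   points satisfying the predicate for the same index congruent modulo [G]. *)
pose P (i : gaussint * nat * nat) (w : 'I_L * 'I_L) :=
  `[< divides (G i.1.2 i.2) (i.1.1 + N%:Z%:~R * box_point w) /\
      forall d, divides (G i.1.2 i.2) (N%:Z%:~R * d) ->
                divides (G i.1.2 i.2) d >].
pose r := [seq (x, b) | x <- [seq (s, m) | s <- S, m <- index_iota m0.+1 M.+1],
                        b <- iota 0 x.2.*2.+1].
have Gge m b : m%:Z ^+ 4 <= gnorm (G m b).
  rewrite /G expr2 gnormM -expr2 (exprM _ 2 2).
  rewrite ler_sqr ?nnegrE ?gnorm_ge0 ?exprn_ge0 //.
  by rewrite /gnorm /= lerDl sqr_ge0.
have cover : forall w, has (P^~ w) r.
  move=> w; have := H (box_point w).
  move=> /existsNP[s /existsNP[g]] /not_implyP[sS] /not_implyP[pg].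
  move=> /not_implyP[gN] /not_implyP[mg] /contrapT gw.
  have [m [b /= [bm ng gG]]] := gauss_associate g.
  apply/hasP; exists (s, m, b); last first.
    apply/asboolP; split; first exact/gG.
    by move=> d /gG /(prime_element_sqr_cancel pg gN) /gG.
  apply/allpairsPdep; exists (s, m), b; split => //; last by rewrite mem_iota.
  apply/allpairsP; exists (s, m); split => //=.
  rewrite mem_index_iota ltnS; apply/andP; split.
    (* The norm of g is m^2 + (b - m)^2, at most 2 m^2, and it exceeds 2 m0^2. *)
    by move: mg; rewrite -ng /gnorm /=; nia.
  have bnd : gnorm (s + N%:Z%:~R * box_point w) <= 2 * (C * L)%N%:Z ^+ 2.
    have cb (x : nat) (z : int) (i : 'I_L) : (absz z <= x)%N ->
        (x + N <= C)%N -> (z + N%:Z * (nat_of_ord i)%:Z) ^+ 2 <= (C * L)%N%:Z ^+ 2.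
      move=> zx xC; rewrite -(real_normK (num_real (_ + _))).
      rewrite ler_sqr ?nnegrE //; have := ltn_ord i; move: (nat_of_ord i) => j jL.
      have : `|z + N%:Z * j%:Z| <= x%:Z + N%:Z * L%:Z by nia.
      by move=> /le_trans; apply; nia.
    rewrite /gnorm !gaussE /= !mul0r subr0 addr0.
    have := cb _ _ w.1 (Hh1 _ sS) C1; have := cb _ _ w.2 (Hh2 _ sS) C2.
    by clear; lia.
  (* A square dividing a nonzero point of the box has bounded norm; this gives m^2 <= 2 C L <= M^2,
     as M^2 = 4 C^2 L. *)
  have m4 : m%:Z ^+ 4 <= 2 * (C * L)%N%:Z ^+ 2.
    apply: le_trans bnd; apply: le_trans (Gge m b) _.
    by apply: gnorm_le_divides; [exact: sN0 | exact/gG].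
  have m2 : m%:Z ^+ 2 <= 2 * (C * L)%N%:Z.
    rewrite -ler_sqr ?nnegrE ?exprn_ge0 // -exprM; apply: le_trans m4 _.
    by rewrite exprMn ler_wpM2r ?sqr_ge0.
  have : m%:Z ^+ 2 <= M%:Z ^+ 2.
    by apply: le_trans m2 _; rewrite EM EL; clear -C0; nia.
  by rewrite ler_sqr ?nnegrE.
have := card_le_sum_cover cover.
rewrite card_prod !card_ord big_allpairs_dep big_allpairs /=.
have le1 (s : gaussint) :
    (\sum_(m0.+1 <= m < M.+1) \sum_(b <- iota 0 m.*2.+1) #|P (s, m, b)|
    <= \sum_(m0.+1 <= m < M.+1) m.*2.+1 * (L %/ (m ^ 2 %/ 2).+1).+1 ^ 2)%N.
  rewrite big_nat_cond [leqRHS]big_nat_cond.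
  apply: leq_sum => m /andP[/andP[mm0 _] _].
  rewrite -sum_const_iota; apply: leq_sum => b _.
  apply: (@box_separated _ _ (G m b)) => //; first by apply: leq_trans mm0.
  move=> v w /asboolP[/= dv HG] /asboolP[/= dw _]; apply: HG.
  rewrite mulrBr (_ : _ - _ =
    (s + N%:Z%:~R * box_point v) - (s + N%:Z%:~R * box_point w)).
    exact: dividesB.
  by rewrite opprD addrACA subrr add0r.
set X := (\sum_(m0.+1 <= m < M.+1) _ * _)%N in le1.
move=> /leq_trans /(_ (leq_sum _ (fun s _ => le1 s))).
have m00 : (0 < m0)%N by exact: leq_ltn_trans Sm0.
have mM : (m0 <= M)%N by rewrite EM; clear -lm C0 l0; nia.
have := sieve_sum rat L m00 mM; rewrite -/X; clearbody X.
rewrite big_const_seq iter_addn_0 count_predT => HX HL.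
have {}HL : L%:R * L%:R <= X%:R * (size S)%:R :> rat.
  by rewrite -!natrM ler_nat.
have {}Sm0 : 48%:R * (size S)%:R < m0%:R :> rat by rewrite -natrM ltr_nat.
have {}lC : 48%:R * (size S)%:R * C%:R ^+ 2 <= l%:R :> rat.
  by rewrite -natrX -!natrM ler_nat.
have {}EM : M%:R = 2%:R * C%:R * l%:R :> rat by rewrite EM !natrM.
have {}EL : L%:R = l%:R ^+ 2 :> rat by rewrite EL natrX.
have L1 : 1 <= l%:R :> rat by rewrite ler1n.
have x0 : 0 < m0%:R :> rat by rewrite ltr0n.
have M0 : 0 <= M%:R^-1 :> rat by rewrite invr_ge0.
exact: (sieve_contradiction HX HL Sm0 lC EM EL L1 x0 M0 (ler0n rat X)).
Qed.

(** * Return times of the square-free Gaussian integers *)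

Lemma PoszX (m n : nat) : (m ^ n)%N%:Z = m%:Z ^+ n.
Proof. exact: (rmorphXn Posz). Qed.

Lemma mod4_eq1 (n : nat) : (0 < n)%N ->
  (forall p, prime p -> (p %| n)%N -> (p %% 4 = 1)%N) -> (n %% 4 = 1)%N.
Proof.
elim/ltn_ind: n => n IH n0 H.
have [n1|n1] := leqP n 1; first by have -> : n = 1%N by lia.
have pp := pdiv_prime n1; have pn := pdiv_dvd n.
have IHp : ((n %/ pdiv n) %% 4 = 1)%N.
  apply: IH; first by rewrite ltn_Pdiv // prime_gt1.
    by rewrite divn_gt0 ?prime_gt0 // dvdn_leq.
  by move=> p pp' pd; apply: H => //; apply: dvdn_trans pd (dvdn_div pn).
by rewrite -(divnK pn) -modnMml IHp mul1n H.
Qed.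

(** Euclid's argument with n = 4 b! - 1: its prime factors are odd and exceed b, and they cannot all
    be 1 modulo 4. *)
Lemma prime_3mod4 (b : nat) : exists p : nat,
  [/\ prime p, (b < p)%N & (p %% 4 = 3)%N].
Proof.
pose n := (b`! * 4).-1.
have nE : n.+1 = (b`! * 4)%N by rewrite prednK // muln_gt0 fact_gt0.
apply: contrapT => /forallNP H.
have n0 : (0 < n)%N by rewrite -ltnS nE; have := fact_gt0 b; lia.
suff : (n %% 4 = 1)%N by lia.
apply: mod4_eq1 => // p pp pn.
have bp : (b < p)%N.
  rewrite ltnNge -(prime_dvdn_fact _ pp); apply/negP => pb.
  have : (p %| n.+1)%N by rewrite nE dvdn_mulr.
  by rewrite -addn1 dvdn_addr // dvdn1 => /eqP p1; rewrite p1 in pp.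
have p3 : (p %% 4)%N <> 3%N by move=> p3; apply: (H p).
have [q Eq] : exists q, n = (q * p)%N by exact/dvdnP.
have : ~~ (2 %| p)%N.
  apply/negP => p2; have : (2 %| n)%N by exact: dvdn_trans pn.
  by clearbody n; lia.
by clear -p3; lia.
Qed.

Lemma sqr_mod4 (a : int) : exists i, a ^+ 2 = 4 * i \/ a ^+ 2 = 4 * i + 1.
Proof.
have [i [->|->]] : exists i, a = 2 * i \/ a = 2 * i + 1.
  by exists (a %/ 2)%Z; lia.
- by exists (i ^+ 2); left; ring.
- by exists (i ^+ 2 + i); right; ring.
Qed.

(** The norm of g divides p^2. It is not 1, since g is no unit, nor p, since a sum of two squares is
    never 3 modulo 4; so it is p^2 and the cofactor is a unit. *)
Lemma prime_element_inert (p : nat) (g : gaussint) :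
  prime p -> (p %% 4 = 3)%N -> prime_element g -> divides g p%:Z%:~R ->
  divides p%:Z%:~R g.
Proof.
move=> pp p3 [g0 g1 _] [c Ec].
have Nn (z : gaussint) : gnorm z = (absz (gnorm z))%:Z.
  by rewrite gez0_abs // gnorm_ge0.
have pgc : (p%:Z ^+ 2 = gnorm c * gnorm g)%R by rewrite -gnormM -Ec gnorm_int.
have : (absz (gnorm g) %| p ^ 2)%N.
  have : (gnorm g %| p%:Z ^+ 2)%Z by rewrite pgc dvdz_mull.
  by rewrite dvdzE abszX.
move=> /(dvdn_pfactor _ _ pp)[[|[|[|//]]] _ Eg].
- by case: g1; have := divides_gnorm g; rewrite Nn Eg.
- have [i Hi] := sqr_mod4 (gre g); have [j Hj] := sqr_mod4 (gim g).
  move: Eg (Nn g); rewrite expn1 => ->; rewrite /gnorm; lia.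
- have c1 : gnorm c = 1.
    apply: (@mulIf _ (gnorm g)); first by rewrite gnorm_eq0.
    by rewrite mul1r -pgc Nn Eg.
  by exists (gconj c); rewrite Ec mulrA [_ * c]mulrC mul_gconj c1 mul1r.
Qed.

(** With f = b!, the point x is divisible by f^2 and congruent to r modulo p. A Gaussian prime
    dividing f does not notice x; one dividing p is associate to p, and p^2 is kept off u + x; any
    other has norm above b, hence within reach of the sieve, whose free parameter w enters as N w
    with N = f^2 p^2. *)
Lemma squarefree_returns (F : seq (int * int)) (b p : nat) r :
  (1 < b)%N -> (size F <= b)%N -> (2 * (48 * size F).+1 ^ 2 <= b)%N ->
  {in F, forall u, gnorm (Gauss u.1 u.2) <= b%:Z} ->
  prime p -> (p %% 4 = 3)%N -> (b < p)%N ->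
  exists x : int * int,
    ((p %| (x - r).1)%Z /\ (p %| (x - r).2)%Z) /\
    {in F, forall u, (u + x \in squarefree_gauss) = (u \in squarefree_gauss)}.
Proof.
move=> b1 sF mF Fb pp p3 bp.
have p0 := prime_gt0 pp.
have [f f0 [fp fb]] : exists2 f, (0 < f)%N & coprime f p /\
    forall m, (0 < m <= b)%N -> (m %| f)%N.
  exists b`!; first exact: fact_gt0.
  rewrite coprime_sym prime_coprime // prime_dvdn_fact // -ltnNge; split=> //.
  by move=> m; exact: dvdn_fact.
pose K := (f ^ 2)%N.
have cKp : coprimez K p by rewrite coprimezE coprimeXl.
have crt (y : int) : exists a, (K %| a)%Z /\ (p %| a - y)%Z.
  exists (zchinese K p 0 y).
  have := zchinese_modl cKp 0 y; have := zchinese_modr cKp 0 y.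
  move/eqP; rewrite eqz_mod_dvd => -> /eqP.
  by rewrite eqz_mod_dvd subr0.
have [a1 [Ka1 pa1]] := crt r.1; have [a2 [Ka2 pa2]] := crt r.2.
have sp : (size [seq u.1 | u <- F] < p)%N.
  by rewrite size_map; apply: leq_ltn_trans bp.
(* Adding multiples of K p keeps the classes modulo K and p while moving the first coordinate modulo
   p^2. *)
have [k Hk] : exists k, {in [seq u.1 | u <- F], forall e,
    ~~ ((p ^ 2)%N %| a1 + (K * p)%N%:Z * k + e)%Z}.
  apply: avoid_residues sp => k.
  have -> : (p ^ 2)%N%:Z = p%:Z * p%:Z by rewrite -mulnn PoszM.
  have -> : (K * p)%N%:Z * k = p%:Z * (K%:Z * k) by rewrite PoszM; ring.
  rewrite dvdz_mul2l; last by rewrite eqz_nat -lt0n.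
  by rewrite Gauss_dvdzr // coprimez_sym.
set y1 := a1 + _ * k in Hk; pose N := (K * p ^ 2)%N.
have Ky1 : (K %| y1)%Z by rewrite rpredD // PoszM -mulrA dvdz_mulr.
have py1 : (p %| y1 - r.1)%Z.
  rewrite /y1 addrAC rpredD // PoszM [_ * p%:Z]mulrC -mulrA; exact: dvdz_mulr.
have {}Hk u v : u \in F -> ~~ ((p ^ 2)%N %| y1 + u.1 + N%:Z * v)%Z.
  move=> uF; have := Hk u.1 (map_f _ uF); apply: contra.
  by rewrite rpredDr // PoszM dvdz_mulr // dvdz_mull.
clearbody y1.
pose S := [seq Gauss (y1 + u.1) (a2 + u.2) | u <- F].
have [||s w|w Hw] := @gauss_sieve S N (48 * size F).+1.
- by rewrite muln_gt0 !expn_gt0 f0 p0.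
- by rewrite size_map.
- move=> /mapP[u uF ->]; apply: contraNneq (Hk u (gre w) uF) => /(congr1 gre).
  by rewrite !gaussE /= mul0r subr0 => ->; exact: dvdz0.
exists (y1 + N%:Z * gre w, a2 + N%:Z * gim w); split.
  by split; rewrite /= addrAC rpredD // PoszM dvdz_mulr // dvdz_mull //
    -mulnn PoszM dvdz_mulr.
move=> u uF; set x := (_, _).
have E : Gauss (u + x).1 (u + x).2 =
    Gauss (y1 + u.1) (a2 + u.2) + N%:Z%:~R * w.
  by apply: gauss_ext; rewrite !gaussE /=; ring.
have Kx : divides (K%:Z%:~R : gaussint) (Gauss x.1 x.2).
  by apply/divides_int; split; rewrite /= rpredD // PoszM -mulrA dvdz_mulr.
have Ex : Gauss (u + x).1 (u + x).2 = Gauss u.1 u.2 + Gauss x.1 x.2.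
  by apply: gauss_ext; rewrite !gaussE.
have p2x : ~ divides ((p ^ 2)%N%:Z%:~R : gaussint) (Gauss (u + x).1 (u + x).2).
  move=> /divides_int[+ _]; rewrite E !gaussE /= mul0r subr0.
  by apply/negP; exact: Hk.
have fK (g : gaussint) : divides g f%:Z%:~R -> divides (g ^+ 2) (Gauss x.1 x.2).
  move=> gf; apply: divides_trans Kx.
  by rewrite /K PoszX rmorphXn; exact: divides_exp.
apply/idP/idP => /set_mem [z0 zsq]; apply/mem_set.
- have u0 : Gauss u.1 u.2 != 0.
    (* If u = 0 then u + x = x is divisible by the square of the prime above 2, which divides f. *)
    apply/eqP => u0; have [g [pg Hg]] := @prime_element_split 2 1 isT isT.
    apply: (zsq g pg); rewrite Ex u0 add0r; apply: fK.
    apply: (@divides_trans _ _ 2%:Z%:~R); first exact/Hg.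
    by apply: divides_int_int; exact: fb.
  split=> //= g pg gu; apply: (zsq g pg); rewrite Ex; apply: dividesD => //.
  have g0 : 0 < gnorm g by rewrite gnorm_gt0; case: pg.
  have ng : gnorm g <= b%:Z.
    apply: le_trans (Fb u uF); apply: le_trans (gnorm_le_divides u0 gu).
    by rewrite expr2 gnormM ler_peMl // -?gtz0_ge1 // ltW.
  apply: fK; apply: divides_trans (divides_gnorm g) _; apply: divides_int_int.
  by rewrite dvdzE; apply: fb; clear -g0 ng; lia.
- split=> [|g pg gx].
    apply/negP => /eqP z; apply: p2x; rewrite z; exists 0; by rewrite mul0r.
  have [gf|gf] := pselect (divides g f%:Z%:~R).
    by apply: (zsq g pg); apply: divides_addl (fK g gf) _; rewrite -Ex.
  have [gp|gp] := pselect (divides g p%:Z%:~R).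
    apply: p2x; apply: divides_trans gx; rewrite PoszX rmorphXn.
    exact/divides_exp/prime_element_inert.
  apply: (Hw _ g (map_f _ uF) pg) _ _; last by rewrite -E.
    rewrite /N PoszM !PoszX rmorphM !rmorphXn; case: (pg) => _ _ gM.
    by move=> /gM[] /(prime_element_exp pg).
  rewrite ltNge; apply/negP => gb; apply: gf.
  apply: divides_trans (divides_gnorm g) _; apply: divides_int_int.
  have g0 : 0 < gnorm g by rewrite gnorm_gt0; case: pg.
  rewrite dvdzE; apply: fb.
  by move: (_.+1) mF g0 gb => m; clear; lia.
Qed.

Lemma X_V_not_factor_of_X_G : ~ topological_factor X_V X_G.
Proof.
apply: no_factor visible_points_neq0 _ => F.
have [b Hb] := seq_bounded (fun u => absz (gnorm (Gauss u.1 u.2))) F.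
have [p [pp bp p3]] := prime_3mod4 (2 + size F + b + 2 * (48 * size F).+1 ^ 2).
exists p, [set x | (p %| x.1)%Z /\ (p %| x.2)%Z]; split.
- exact: prime_gt0.
- move=> x y [x1 x2] y1 y2; split.
    by rewrite -(subrK x.1 y.1) rpredD.
  by rewrite -(subrK x.2 y.2) rpredD.
- move=> x [x1 x2] /mem_set /visibleP /(_ p pp); by rewrite x1 x2.
- move=> r; apply: (squarefree_returns r _ _ _ _ pp p3 bp) => //.
  + by rewrite -!addnA addnCA leq_addr.
  + by rewrite leq_addl.
  + move=> u uF; have := Hb u uF; have := gnorm_ge0 (Gauss u.1 u.2).
    by move: (2 * _)%N (gnorm _); lia.
Qed.

Theorem proposition5p6 :
  ~ topological_factor X_V X_G /\ ~ topological_factor X_G X_V.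
Proof. by split; [exact: X_V_not_factor_of_X_G | exact: X_G_not_factor_of_X_V]. Qed.
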